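(* Let $t(n)$ be a sequence of natural numbers, let $\mathrm{GF}_t(z)=\sum_{i=0}^\infty t(i)z^i$ and let $R$ be the radius of convergence of $\mathrm{GF}_t(z)$ at zero. Let $b$ and $n$ be positive integers such that $b\ge 8$, $b^{-1}<R$, and $t(r)<b^{r/3}$ for every integer $r\ge 1$. Then $$t(n)=\left\lfloor b^{n^2}\,\mathrm{GF}_t(b^{-n})\right\rfloor \bmod b^n .$$
   Context: Natural numbers are the non-negative integers. $\mathrm{GF}_t(b^{-n})$ denotes the (real) sum of the power series $\sum_{i\ge 0} t(i) b^{-ni}$. For an integer $y\ge 1$, $x \bmod y$ denotes the least non-negative residue of $x$ modulo $y$. *)

(* Defs.v *)
From Stdlib Require Import Reals ZArith.
From Coquelicot Require Import Coquelicot.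

Open Scope R_scope.

Definition GF_coef (t : nat -> nat) : nat -> R := fun i => INR (t i).

Definition GF (t : nat -> nat) (z : R) : R := PSeries (GF_coef t) z.

(* Possibly [p_infty], e.g. when [t] is eventually zero. *)
Definition GF_radius (t : nat -> nat) : Rbar := CV_radius (GF_coef t).

(* Main.v *)
Require Import Defs.
From Stdlib Require Import Reals ZArith Lra Lia.
From Coquelicot Require Import Coquelicot.

Open Scope R_scope.

(** Put [M = b ^ n]. In [M ^ n * GF t (/ M)] the terms of index less than [n] are
    multiples of [M], the term of index [n] is [t n], and the later ones add up to
    [(t (n+1) + t (n+2) / M + ...) / M]. If [t k <= c ^ k] this remainder is at most
    [c ^ (n+1) / (M - c)], which for [M = c ^ (3 n)] and [c >= 2] is less than [1],
    so the floor removes it. The base [8] makes the cube root [c] of [b] at least [2]. *)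

Lemma Rpower_mult_INR (x y : R) (k : nat) : Rpower x (y * INR k) = Rpower x y ^ k.
Proof.
rewrite <- Rpower_mult.
apply Rpower_pow, exp_pos.
Qed.

Lemma pow_Rpower_inv (k : nat) (x : R) :
  (0 < k)%nat -> 0 < x -> Rpower x (/ INR k) ^ k = x.
Proof.
intros Hk Hx.
rewrite <- Rpower_mult_INR, Rinv_l by (apply not_0_INR; lia).
now apply Rpower_1.
Qed.

Lemma le_Rpower_inv (k : nat) (x y : R) :
  (0 < k)%nat -> 0 < x -> x ^ k <= y -> x <= Rpower y (/ INR k).
Proof.
intros Hk Hx Hxy.
assert (HINRk : 0 < INR k) by (apply lt_0_INR; lia).
assert (Hroot : Rpower (x ^ k) (/ INR k) = x).
{ rewrite <- Rpower_pow, Rpower_mult, Rinv_r by lra.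
  now apply Rpower_1. }
rewrite <- Hroot at 1.
apply Rle_Rpower_l.
- now apply Rlt_le, Rinv_0_lt_compat.
- split; [now apply pow_lt | exact Hxy].
Qed.

Lemma pow_S_plus_lt_pow_mul3 (c : R) (n : nat) :
  2 <= c -> (0 < n)%nat -> c ^ S n + c < c ^ (3 * n).
Proof.
intros Hc Hn.
assert (Hlow : c < c ^ S n) by (rewrite <- (pow_1 c) at 1; apply Rlt_pow; [lra | lia]).
assert (Hdouble : 2 * c ^ S n <= c ^ S (S n)) by (simpl in *; nra).
assert (Hhigh : c ^ S (S n) <= c ^ (3 * n)) by (apply Rle_pow; [lra | lia]).
lra.
Qed.

Lemma PSeries_ge_0 (a : nat -> R) (x : R) :
  0 <= x -> (forall k, 0 <= a k) -> ex_pseries a x -> 0 <= PSeries a x.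
Proof.
intros Hx Ha Hex.
rewrite <- (PSeries_const_0 x).
apply Series_le; [| now apply ex_pseries_R].
intros k; rewrite Rmult_0_l; split; [apply Rle_refl |].
apply Rmult_le_pos; [apply Ha | now apply pow_le].
Qed.

Lemma PSeries_le_geom (a : nat -> R) (C c x : R) :
  0 <= x -> 0 <= c -> c * x < 1 -> (forall k, 0 <= a k <= C * c ^ k) ->
  PSeries a x <= C / (1 - c * x).
Proof.
intros Hx Hc Hcx Ha.
assert (Habs : Rabs (c * x) < 1).
{ rewrite Rabs_pos_eq; [exact Hcx | now apply Rmult_le_pos]. }
unfold Rdiv; rewrite <- Series_geom, <- Series_scal_l by exact Habs.
apply Series_le.
- intros k; specialize (Ha k).
  assert (Hxk : 0 <= x ^ k) by now apply pow_le.
  rewrite Rpow_mult_distr, <- Rmult_assoc; split.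
  + now apply Rmult_le_pos.
  + now apply Rmult_le_compat_r.
- apply (ex_series_scal_l (V := R_NormedModule) C), ex_series_geom, Habs.
Qed.

Lemma scaled_partial_sum_eq_last_mod (t : nat -> nat) (M n : nat) :
  (0 < M)%nat ->
  exists q : nat,
    INR M ^ n * sum_f_R0 (fun i => GF_coef t i * (/ INR M) ^ i) n = INR (t n + q * M).
Proof.
intros HM.
assert (HM0 : INR M <> 0) by (apply not_0_INR; lia).
induction n as [| n [q Hq]].
- exists 0%nat; simpl; unfold GF_coef; rewrite Nat.add_0_r; ring.
- exists (t n + q * M)%nat.
  rewrite tech5, Rmult_plus_distr_l, plus_INR, mult_INR, <- Hq, pow_inv.
  simpl pow; unfold GF_coef; field.
  split; [now apply pow_nonzero | exact HM0].
Qed.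

Lemma Zfloor_scaled_GF_mod (t : nat -> nat) (M n : nat) :
  (t n < M)%nat -> ex_pseries (GF_coef t) (/ INR M) ->
  PSeries (PS_decr_n (GF_coef t) (S n)) (/ INR M) < INR M ->
  (Zfloor (INR M ^ n * GF t (/ INR M)) mod Z.of_nat M)%Z = Z.of_nat (t n).
Proof.
intros HtM Hex Htail.
assert (HM : 0 < INR M) by (apply lt_0_INR; lia).
assert (HMinv : 0 < / INR M) by now apply Rinv_0_lt_compat.
set (tail := PSeries (PS_decr_n (GF_coef t) (S n)) (/ INR M)) in *.
assert (Htail0 : 0 <= tail).
{ apply PSeries_ge_0; [lra | intros k; apply pos_INR |].
  apply (ex_pseries_decr_n (GF_coef t)); [| exact Hex].
  right; exists (INR M); apply Rinv_r; lra. }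
destruct (scaled_partial_sum_eq_last_mod t M n ltac:(lia)) as [q Hq].
assert (Hsplit : INR M ^ n * GF t (/ INR M) = INR (t n + q * M) + tail / INR M).
{ unfold GF; rewrite (PSeries_decr_n _ n) by exact Hex.
  rewrite Rmult_plus_distr_l, Hq; fold tail.
  rewrite pow_inv; simpl pow; field.
  split; [lra | apply pow_nonzero; lra]. }
assert (Hfrac : 0 <= tail / INR M < 1).
{ split; [now apply Rdiv_le_0_compat | now apply (Rdiv_lt_1 tail)]. }
rewrite Hsplit, (Zfloor_eq (Z.of_nat (t n + q * M)))
  by (rewrite <- INR_IZR_INZ; lra).
rewrite Nat2Z.inj_add, Nat2Z.inj_mul, Z.mod_add by lia.
apply Z.mod_small; lia.
Qed.

Lemma Zfloor_scaled_GF_mod_geom (t : nat -> nat) (M n : nat) (c : R) :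
  0 <= c -> (t n < M)%nat -> ex_pseries (GF_coef t) (/ INR M) ->
  (forall k, (n < k)%nat -> INR (t k) <= c ^ k) -> c ^ S n + c < INR M ->
  (Zfloor (INR M ^ n * GF t (/ INR M)) mod Z.of_nat M)%Z = Z.of_nat (t n).
Proof.
intros Hc HtM Hex Hgrowth HcM.
assert (HM : 0 < INR M) by (apply lt_0_INR; lia).
assert (Hcn : 0 <= c ^ S n) by now apply pow_le.
assert (Hratio : c * / INR M < 1) by (apply (Rdiv_lt_1 c); lra).
apply Zfloor_scaled_GF_mod; [exact HtM | exact Hex |].
apply Rle_lt_trans with (c ^ S n / (1 - c * / INR M)).
- apply PSeries_le_geom; [| exact Hc | exact Hratio |].
  + now apply Rlt_le, Rinv_0_lt_compat.
  + intros k; rewrite <- pow_add; split; [apply pos_INR |].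
    apply Hgrowth; lia.
- apply Rlt_div_l; [lra |].
  replace (INR M * (1 - c * / INR M)) with (INR M - c) by (field; lra).
  lra.
Qed.

Lemma ex_pseries_inv_pow (a : nat -> R) (x : R) (n : nat) :
  1 <= x -> (0 < n)%nat -> Rbar_lt (/ x) (CV_radius a) -> ex_pseries a (/ x ^ n).
Proof.
intros Hx Hn HR.
assert (Hpow : x <= x ^ n) by (rewrite <- (pow_1 x) at 1; apply Rle_pow; [exact Hx | lia]).
apply CV_radius_inside, Rbar_le_lt_trans with (2 := HR); simpl.
rewrite Rabs_pos_eq.
- apply Rinv_le_contravar; lra.
- apply Rlt_le, Rinv_0_lt_compat; lra.
Qed.

Theorem theorem4p2 (t : nat -> nat) (b n : nat)
  (hb0 : (0 < b)%nat) (hn0 : (0 < n)%nat)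
  (hb : (8 <= b)%nat)
  (hR : Rbar_lt (Finite (/ INR b)) (GF_radius t))
  (ht : forall r : nat, (1 <= r)%nat -> INR (t r) < Rpower (INR b) (INR r / 3)) :
  Z.of_nat (t n) =
    (Zfloor (INR b ^ (n ^ 2) * GF t (/ (INR b ^ n))) mod Z.of_nat (b ^ n))%Z.
Proof.
assert (HB : 8 <= INR b) by (apply le_INR in hb; simpl in hb; lra).
set (c := Rpower (INR b) (/ INR 3)).
assert (Hc : 2 <= c) by (apply le_Rpower_inv; [lia | lra | lra]).
assert (Hgrowth : forall r, (1 <= r)%nat -> INR (t r) < c ^ r).
{ intros r Hr; unfold c; rewrite <- Rpower_mult_INR.
  replace (/ INR 3 * INR r) with (INR r / 3) by (simpl; field).
  now apply ht. }
assert (HM : INR (b ^ n) = c ^ (3 * n)).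
{ rewrite pow_INR, pow_mult; unfold c; rewrite pow_Rpower_inv; [easy | lia | lra]. }
replace (n ^ 2)%nat with (n * n)%nat by (simpl; lia).
rewrite pow_mult, <- pow_INR; symmetry.
apply (Zfloor_scaled_GF_mod_geom t (b ^ n) n c).
- lra.
- apply INR_lt; rewrite HM; apply Rlt_le_trans with (1 := Hgrowth n hn0).
  apply Rle_pow; [lra | lia].
- rewrite pow_INR; apply ex_pseries_inv_pow; [lra | exact hn0 | exact hR].
- intros k Hk; apply Rlt_le, Hgrowth; lia.
- rewrite HM; now apply pow_S_plus_lt_pow_mul3.
Qed.
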